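(* Let $G=(V,E)$ be a finite simple graph of order $n\ge 1$ with maximum degree $\delta_1$ and minimum degree $\delta_n$. For every integer $k\in\{-\delta_n,\dots,\delta_1\}$ such that $G$ contains a defensive $k$-alliance, $$\left\lceil\frac{\delta_n+k+2}{2}\right\rceil \le a_k(G)\le n-\left\lfloor\frac{\delta_n-k}{2}\right\rfloor .$$
   Context: For a nonempty set $X\subseteq V$ and $v\in V$, $\delta_X(v)$ denotes the number of neighbors of $v$ in $X$ (with $\delta_{\emptyset}(v)=0$), and $\bar S=V\setminus S$. For an integer $k$, a nonempty set $S\subseteq V$ is a defensive $k$-alliance in $G$ if $\delta_S(v)\ge \delta_{\bar S}(v)+k$ for every $v\in S$. The defensive $k$-alliance number $a_k(G)$ is the minimum cardinality of a defensive $k$-alliance in $G$. (For $k\le\delta_n$ a defensive $k$-alliance always exists, e.g. $S=V$.) *)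

(* Defs.v *)
From HB Require Import structures.
From mathcomp Require Import all_boot all_order all_algebra.

Set Implicit Arguments.
Unset Strict Implicit.
Unset Printing Implicit Defensive.

Import Order.TTheory GRing.Theory Num.Theory.

Definition simple_graph (V : finType) (adj : rel V) : Prop :=
  symmetric adj /\ irreflexive adj.

Definition degree_in (V : finType) (adj : rel V) (X : {set V}) (v : V) : nat :=
  #|[set u in X | adj v u]|.

Definition degree (V : finType) (adj : rel V) (v : V) : nat :=
  #|[set u | adj v u]|.

Definition max_degree (V : finType) (adj : rel V) : nat :=
  \max_(v : V) degree adj v.

(* The default value #|V| bounds every degree, so this is the true minimum as
   soon as V is nonempty. *)
Definition min_degree (V : finType) (adj : rel V) : nat :=
  \big[minn/#|V|]_(v : V) degree adj v.

Definition defensive_alliance (V : finType) (adj : rel V) (k : int)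
    (S : {set V}) : bool :=
  (S != set0) &&
  [forall v in S,
     ((degree_in adj (~: S) v)%:Z + k <= (degree_in adj S v)%:Z)%R].

(* The default value #|V| bounds every cardinality, so this is the true minimum
   as soon as some defensive k-alliance exists. *)
Definition alliance_number (V : finType) (adj : rel V) (k : int) : nat :=
  \big[minn/#|V|]_(S : {set V} | defensive_alliance adj k S) #|S|.

Lemma bigminn_le (I : finType) (m : nat) (P : pred I) (F : I -> nat) (j : I) :
  P j -> \big[minn/m]_(i | P i) F i <= F j.
Proof.
move=> Pj; have := mem_index_enum j.
elim: (index_enum I) => //= i r IH; rewrite inE big_cons.
case/predU1P => [<-|/IH h]; first by rewrite Pj geq_minl.
by case: ifP => _ //; apply: leq_trans (geq_minr _ _) h.
Qed.

Lemma bigminn_attained (I : finType) (m : nat) (P : pred I) (F : I -> nat) :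
  (forall i, P i -> F i <= m) -> (exists i, P i) ->
  exists2 i, P i & F i = \big[minn/m]_(i | P i) F i.
Proof.
move=> Fm [i0 Pi0].
have [[i Pi e]|e] : (exists2 i, P i & F i = \big[minn/m]_(i | P i) F i)
                    \/ \big[minn/m]_(i | P i) F i = m.
- elim/big_ind: _ => [|x y hx hy|i Pi]; [by right| |by left; exists i].
  by rewrite /minn; case: ifP.
- by exists i.
- exists i0 => //; apply/eqP; rewrite eqn_leq bigminn_le // andbT e.
  exact: Fm.
Qed.

Lemma alliance_number_le (V : finType) (adj : rel V) (k : int) (S : {set V}) :
  defensive_alliance adj k S -> alliance_number adj k <= #|S|.
Proof. exact: bigminn_le. Qed.

Lemma alliance_number_attained (V : finType) (adj : rel V) (k : int) :
  (exists S : {set V}, defensive_alliance adj k S) ->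
  exists2 S : {set V},
    defensive_alliance adj k S & #|S| = alliance_number adj k.
Proof. by apply: bigminn_attained => S _; exact: max_card. Qed.

Lemma min_degree_le (V : finType) (adj : rel V) (v : V) :
  min_degree adj <= degree adj v.
Proof. exact: bigminn_le. Qed.

Lemma min_degree_attained (V : finType) (adj : rel V) :
  0 < #|V| -> exists v, degree adj v = min_degree adj.
Proof.
case/card_gt0P => v0 _.
have [v _ e] := @bigminn_attained V #|V| predT (degree adj)
  (fun v _ => max_card _) (ex_intro _ v0 isT).
by exists v.
Qed.

(* Main.v *)
Require Import Defs.
From HB Require Import structures.
From mathcomp Require Import all_boot all_order all_algebra.
From mathcomp Require Import zify.

Import Order.TTheory GRing.Theory Num.Theory.
Local Open Scope ring_scope.

(** In an alliance [S], a vertex splits its degree into [x] neighbours inside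
    and [y] outside, with [y + k <= x]; hence [x + y + k <= 2x].

    Lower bound: [x + y] is at least the minimum degree, and [x <= #|S| - 1]
    because a vertex is not its own neighbour ([alliance_card_ge]).

    Upper bound: removing any [m] vertices from the whole graph costs a
    surviving vertex at most [m] neighbours, so [y <= m], and the survivors form
    an alliance as soon as [2m + k] does not exceed the minimum degree
    ([alliance_of_small_complement]).  The floor in the statement is the largest
    such [m].  A vertex does remain: [k] is at least minus the minimum degree,
    which makes [m] at most the minimum degree and hence less than the order.

    When [k] exceeds the minimum degree, the floor is negative and the bound is weaker than the trivial one. *)

Lemma degree_split (V : finType) (adj : rel V) (S : {set V}) (v : V) :
  degree adj v = (degree_in adj S v + degree_in adj (~: S) v)%N.
Proof.
rewrite /degree /degree_in -(cardsID S); congr (_ + _)%N;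
  by apply: eq_card => u; rewrite !inE andbC.
Qed.

Lemma degree_in_le_card (V : finType) (adj : rel V) (X : {set V}) (v : V) :
  (degree_in adj X v <= #|X|)%N.
Proof. by apply/subset_leq_card/subsetP => u; rewrite inE => /andP[]. Qed.

Lemma degree_in_lt_card (V : finType) (adj : rel V) (X : {set V}) (v : V) :
  irreflexive adj -> v \in X -> (degree_in adj X v < #|X|)%N.
Proof.
move=> irr vX; apply/proper_card/properP; split.
  by apply/subsetP => u; rewrite inE => /andP[].
by exists v; rewrite // inE irr andbF.
Qed.

Lemma min_degree_lt_order (V : finType) (adj : rel V) :
  irreflexive adj -> (0 < #|V|)%N -> (min_degree adj < #|V|)%N.
Proof.
move=> irr /card_gt0P[v _]; apply: leq_ltn_trans (min_degree_le adj v) _.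
have := degree_in_lt_card V adj setT v irr (in_setT v).
suff -> : degree_in adj setT v = degree adj v by rewrite cardsT.
by apply: eq_card => u; rewrite !inE.
Qed.

(** Since [S] is nonempty, the degree count can be read off at one of its
    vertices; clearing denominators keeps the bound within the integers. *)
Lemma alliance_card_ge (V : finType) (adj : rel V) (k : int) (S : {set V}) :
  irreflexive adj -> defensive_alliance adj k S ->
  (min_degree adj)%:Z + k + 2 <= 2 * #|S|%:Z.
Proof.
move=> irr /andP[/set0Pn[v vS] /forall_inP /(_ v vS)].
have := degree_in_lt_card V adj S v irr vS.
have := min_degree_le adj v; rewrite (degree_split V adj S).
lia.
Qed.

(** Each vertex of [S] has at most [#|~: S|] enemies and all its other
    neighbours as allies. *)
Lemma alliance_of_small_complement (V : finType) (adj : rel V) (k : int)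
    (S : {set V}) :
  S != set0 -> 2 * #|~: S|%:Z + k <= (min_degree adj)%:Z ->
  defensive_alliance adj k S.
Proof.
move=> S0 hS; rewrite /defensive_alliance S0; apply/forall_inP => v _.
have := degree_in_le_card V adj (~: S) v.
have := min_degree_le adj v; rewrite (degree_split V adj S).
lia.
Qed.

Lemma exists_set_card (T : finType) (m : nat) :
  (m <= #|T|)%N -> exists A : {set T}, #|A| = m.
Proof.
rewrite -bin_gt0 -card_draws => /card_gt0P[A].
by rewrite inE => /eqP; exists A.
Qed.

Lemma alliance_number_le_order_sub (V : finType) (adj : rel V) (k : int)
    (m : nat) :
  (m < #|V|)%N -> 2 * m%:Z + k <= (min_degree adj)%:Z ->
  (alliance_number adj k <= #|V| - m)%N.
Proof.
move=> mV hm; have [A cA] := exists_set_card V m (ltnW mV).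
have cAC : #|~: A| = (#|V| - m)%N by rewrite cardsCs setCK cA.
rewrite -cAC; apply/alliance_number_le/alliance_of_small_complement.
  by rewrite -card_gt0 cAC subn_gt0.
by rewrite setCK cA.
Qed.

Theorem theorem1 (V : finType) (adj : rel V) (k : int)
    (hV : (1 <= #|V|)%N)
    (hG : simple_graph adj)
    (hk : - (min_degree adj)%:Z <= k <= (max_degree adj)%:Z)
    (hex : exists S : {set V}, defensive_alliance adj k S) :
  Num.ceil ((((min_degree adj)%:Z + k + 2)%:~R : rat) / 2)
    <= (alliance_number adj k)%:Z
  /\ (alliance_number adj k)%:Z
    <= #|V|%:Z - Num.floor ((((min_degree adj)%:Z - k)%:~R : rat) / 2).
Proof.
case: hG => _ irr; have [S allS cS] := alliance_number_attained hex.
split.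
  rewrite ceil_le_int ler_pdivrMr // -cS.
  have -> : (2 : rat) = 2%:~R by [].
  by rewrite -intrM ler_int mulrC; apply: alliance_card_ge.
set f := Num.floor _.
have hf : 2 * f <= (min_degree adj)%:Z - k.
  have : f%:~R <= (((min_degree adj)%:Z - k)%:~R : rat) / 2 by apply: floor_le.
  rewrite ler_pdivlMr //.
  have -> : (2 : rat) = 2%:~R by [].
  by rewrite -intrM ler_int mulrC.
have hlt := min_degree_lt_order V adj irr hV.
case: f hf => [m|m] hf; last first.
  (* A negative floor puts the bound above the order. *)
  have : (#|S| <= #|V|)%N by apply: max_card.
  by rewrite cS; lia.
have mV : (m < #|V|)%N by lia.
have := alliance_number_le_order_sub V adj k m mV.
lia.
Qed.
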